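(* Let $V=\bigoplus_{n=0}^{\infty}V_{(n)}$ be an $\mathbb{N}$-graded vertex algebra over $\mathbb{C}$ such that: (a) $2\leq \dim V_{(0)}<\infty$, $1\leq \dim V_{(1)}<\infty$, and $V$ is generated (as a vertex algebra) by $V_{(0)}$ and $V_{(1)}$; (b) $V_{(0)}$ is a local algebra. Let $\mathrm{rad}\langle\ ,\ \rangle=\{u\in V_{(1)} \mid u_1b=0 \text{ for all } b\in V_{(1)}\}$, $\mathrm{Ann}_{V_{(1)}}(V_{(0)})=\{b\in V_{(1)}\mid b_0a=0\text{ for all }a\in V_{(0)}\}$ and $V_{(0)}D(V_{(0)})=\mathrm{Span}\{a_{-1}D(a')\mid a,a'\in V_{(0)}\}$. Assume that one of the following statements holds: (i) the ideal of $V$ generated by $\mathrm{rad}\langle\ ,\ \rangle$ is not zero; (ii) $V_{(0)}$ is not a simple module for the Lie $V_{(0)}$-algebroid $V_{(1)}/\mathrm{Ann}_{V_{(1)}}(V_{(0)})$; (iii) $V_{(0)}$ is not a simple module for the Lie $V_{(0)}$-algebroid $V_{(1)}/V_{(0)}D(V_{(0)})$. Then $V$ is an indecomposable non-simple vertex algebra.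
   Context: All vector spaces are over $\mathbb{C}$; $\mathbb{N}=\{0,1,2,\dots\}$. A vertex algebra is a vector space $V$ with a linear map $Y:V\to \mathrm{End}(V)[[x,x^{-1}]]$, $v\mapsto Y(v,x)=\sum_{n\in\mathbb{Z}}v_nx^{-n-1}$, and a vacuum vector $\mathbf{1}$ such that for all $u,v\in V$: $u_nv=0$ for $n$ sufficiently large; $Y(\mathbf{1},x)=1$; $Y(v,x)\mathbf{1}\in V[[x]]$ and $\lim_{x\to0}Y(v,x)\mathbf{1}=v$; and the Jacobi identity holds: $x_0^{-1}\delta\left(\frac{x_1-x_2}{x_0}\right)Y(u,x_1)Y(v,x_2)-x_0^{-1}\delta\left(\frac{x_2-x_1}{-x_0}\right)Y(v,x_2)Y(u,x_1)=x_2^{-1}\delta\left(\frac{x_1-x_0}{x_2}\right)Y(Y(u,x_0)v,x_2)$. The operator $D$ on $V$ is $D(v)=v_{-2}\mathbf{1}$. $V$ is $\mathbb{N}$-graded if $V=\bigoplus_{n\in\mathbb{N}}V_{(n)}$, $\mathbf{1}\in V_{(0)}$, and $u_mV_{(n)}\subseteq V_{(k+n-m-1)}$ for $u\in V_{(k)}$, $m\in\mathbb{Z}$ (with $V_{(j)}=0$ for $j<0$). $V$ is generated by a subset $S$ if the smallest vertex subalgebra containing $S$ is $V$. An ideal of $V$ is a subspace $I$ with $v_nw\in I$ and $w_nv\in I$ for all $v\in V$, $w\in I$, $n\in\mathbb{Z}$; the ideal generated by a subset is the smallest ideal containing it. $V$ is simple if its only ideals are $0$ and $V$; $V$ is decomposable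 if $V=U\oplus W$ for nonzero proper ideals $U,W$, and indecomposable otherwise. $V_{(0)}$ is a unital commutative associative algebra with product $a*a'=a_{-1}a'$ and identity $\mathbf{1}$; it is local if it has a unique maximal ideal. A Lie $A$-algebroid ($A$ a commutative associative algebra) is a Lie algebra $\mathfrak{g}$ with an $A$-module structure and a module action on $A$ by derivations such that $[u,av]=a[u,v]+(ua)v$ and $a(ub)=(au)b$ for $u,v\in\mathfrak{g}$, $a,b\in A$. A module for it is a vector space $W$ with a $\mathfrak{g}$-module and an $A$-module structure such that $u(aw)-a(uw)=(ua)w$ and $a(uw)=(au)w$ for $a\in A,u\in\mathfrak{g},w\in W$. A submodule is a subspace stable under both $\mathfrak{g}$ and $A$; a module is simple if it is nonzero and has no submodules other than $0$ and itself. The quotients $V_{(1)}/\mathrm{Ann}_{V_{(1)}}(V_{(0)})$ and $V_{(1)}/V_{(0)}D(V_{(0)})$ are Lie $V_{(0)}$-algebroids with structure induced by $[u,v]=u_0v$, $au=a_{-1}u$, and action on $V_{(0)}$ induced by $u\cdot a=u_0a$ ($u,v\in V_{(1)}$, $a\in V_{(0)}$); $V_{(0)}$ is a module for each of them via $u\cdot a=u_0a$ and $a\cdot a'=a_{-1}a'$. *)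

(* Defs.v *)
From HB Require Import structures.
From mathcomp Require Import all_boot all_order all_algebra.
From mathcomp Require Import finmap mathcomp_extra boolp classical_sets.
From mathcomp Require Import cardinality fsbigop reals.
From mathcomp Require Import zify ring lra.
From mathcomp.real_closed Require Import complex.

Set Implicit Arguments.
Unset Strict Implicit.
Unset Printing Implicit Defensive.
Import Order.TTheory GRing.Theory Num.Theory.

Local Open Scope classical_set_scope.
Local Open Scope quotient_scope.
Local Open Scope ring_scope.

Section Subspaces.
Variables (K : pzRingType) (U : lmodType K).

Definition subspace (S : set U) := submod_closed [in S].

Definition linear_span (X : set U) : set U := smallest subspace X.

Definition has_dim (d : nat) :=
  exists e : 'I_d -> U,
    (forall c : 'I_d -> K, \sum_i c i *: e i = 0 -> forall i, c i = 0) /\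
    (forall x, exists c : 'I_d -> K, x = \sum_i c i *: e i).

Lemma subspaceP (S : set U) :
  subspace S <-> S 0 /\ (forall k x y, S x -> S y -> S (k *: x + y)).
Proof.
split=> [[S0 Slin]|[S0 Slin]]; split; try exact/mem_set.
- by move/set_mem: S0.
- by move=> k x y /mem_set Sx /mem_set Sy; apply/set_mem/Slin.
- by move=> k x y /set_mem Sx /set_mem Sy; apply/mem_set/Slin.
Qed.

Lemma linear_span_subspace (X : set U) : subspace (linear_span X).
Proof.
apply/subspaceP; split=> [S [/subspaceP[]] //|k x y Xx Xy S [SS XS]].
by case/subspaceP: (SS) => _; apply; [apply: Xx|apply: Xy].
Qed.
End Subspaces.

Arguments has_dim {K} U d.

Record commAlgebra (K : pzRingType) := CommAlgebra {
  ca_sort :> lmodType K;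
  ca_mul : ca_sort -> ca_sort -> ca_sort;
  ca_one : ca_sort;
  ca_mulA : associative ca_mul;
  ca_mulC : commutative ca_mul;
  ca_mul1 : left_id ca_one ca_mul;
  ca_mul_linear : forall a, linear (ca_mul a)
}.

Section LocalAlgebras.
Variables (K : pzRingType) (A : commAlgebra K).
Implicit Types I J M : set A.

Definition alg_ideal I := subspace I /\ forall a x, I x -> I (ca_mul a x).

Definition maximal_ideal M :=
  [/\ alg_ideal M, M <> setT &
      forall J, alg_ideal J -> M `<=` J -> J = M \/ J = setT].

Definition local_algebra := exists! M, maximal_ideal M.
End LocalAlgebras.

(* [la_act u a] is the derivation action of u on a, written ua. *)
Record lieAlgebroid (K : pzRingType) (A : commAlgebra K) := LieAlgebroid {
  la_sort :> lmodType K;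
  la_bracket : la_sort -> la_sort -> la_sort;
  la_scale : A -> la_sort -> la_sort;
  la_act : la_sort -> A -> A;
  la_bracket_linearl : forall v, linear (la_bracket^~ v);
  la_bracket_linearr : forall u, linear (la_bracket u);
  la_bracket_alt : forall u, la_bracket u u = 0;
  la_bracket_jacobi : forall u v w,
    la_bracket u (la_bracket v w) =
    la_bracket (la_bracket u v) w + la_bracket v (la_bracket u w);
  la_scale_linearl : forall u, linear (la_scale^~ u);
  la_scale_linearr : forall a, linear (la_scale a);
  la_scale1 : forall u, la_scale (ca_one A) u = u;
  la_scaleA : forall a b u,
    la_scale (ca_mul a b) u = la_scale a (la_scale b u);
  la_act_linearl : forall a, linear (la_act^~ a);
  la_act_linearr : forall u, linear (la_act u);
  la_act_bracket : forall u v a,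
    la_act (la_bracket u v) a = la_act u (la_act v a) - la_act v (la_act u a);
  la_act_derivation : forall u a b,
    la_act u (ca_mul a b) = ca_mul (la_act u a) b + ca_mul a (la_act u b);
  la_bracket_scale : forall u v a,
    la_bracket u (la_scale a v) =
    la_scale a (la_bracket u v) + la_scale (la_act u a) v;
  la_act_scale : forall a u b,
    ca_mul a (la_act u b) = la_act (la_scale a u) b
}.

Record lieAlgebroidModule (K : pzRingType) (A : commAlgebra K)
    (L : lieAlgebroid A) := LieAlgebroidModule {
  lam_sort :> lmodType K;
  lam_act : L -> lam_sort -> lam_sort;
  lam_scale : A -> lam_sort -> lam_sort;
  lam_act_linearl : forall w, linear (lam_act^~ w);
  lam_act_linearr : forall u, linear (lam_act u);
  lam_act_bracket : forall u v w,
    lam_act (la_bracket u v) w =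
    lam_act u (lam_act v w) - lam_act v (lam_act u w);
  lam_scale_linearl : forall w, linear (lam_scale^~ w);
  lam_scale_linearr : forall a, linear (lam_scale a);
  lam_scale1 : forall w, lam_scale (ca_one A) w = w;
  lam_scaleA : forall a b w,
    lam_scale (ca_mul a b) w = lam_scale a (lam_scale b w);
  lam_act_leibniz : forall u a w,
    lam_act u (lam_scale a w) - lam_scale a (lam_act u w) =
    lam_scale (la_act u a) w;
  lam_act_scale : forall a u w,
    lam_scale a (lam_act u w) = lam_act (la_scale a u) w
}.

Section SimpleModules.
Variables (K : pzRingType) (A : commAlgebra K) (L : lieAlgebroid A).
Variable W : lieAlgebroidModule L.

Definition lam_submodule (S : set W) :=
  [/\ subspace S,
      forall (u : L) w, S w -> S (lam_act u w) &
      forall (a : A) w, S w -> S (lam_scale a w)].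

Definition lam_simple :=
  (exists w : W, w <> 0) /\
  forall S, lam_submodule S -> S = [set 0] \/ S = setT.
End SimpleModules.

Section QuotientModule.
Variables (K : pzRingType) (U : lmodType K) (S : submodClosed U).

Definition lquot_pred : {pred U} := S.
Fact lquot_predN : oppr_closed lquot_pred.
Proof. by move=> x Sx; rewrite -scaleN1r; apply: rpredZ. Qed.
HB.instance Definition _ := GRing.SubmodClosed.on lquot_pred.
HB.instance Definition _ := GRing.isOppClosed.Build U lquot_pred lquot_predN.

Definition lquot := Quotient.quot lquot_pred.
HB.instance Definition _ := GRing.Zmodule.on lquot.
HB.instance Definition _ := EqQuotient.on lquot.

Lemma lquot_eqP (x y : U) : \pi_lquot x = \pi_lquot y <-> x - y \in S.
Proof. have -> : (x - y \in S) = (x - y \in lquot_pred) by [].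
by rewrite Quotient.idealrBE; split=> [|] /eqP. Qed.

Lemma lquotW (P : lquot -> Prop) :
  (forall x, P (\pi_lquot x)) -> forall x, P x.
Proof. by move=> Px x; rewrite -[x]reprK; apply: Px. Qed.

Lemma pi_lquotD (x y : U) : \pi_lquot (x + y) = \pi_lquot x + \pi_lquot y.
Proof. by rewrite !piE. Qed.

Lemma pi_lquotN (x : U) : \pi_lquot (- x) = - \pi_lquot x.
Proof. by rewrite !piE. Qed.

Lemma pi_lquot0 : \pi_lquot 0 = 0.
Proof. by rewrite !piE. Qed.

Definition lquot_scale (k : K) (x : lquot) : lquot := \pi_lquot (k *: repr x).

Lemma pi_lquot_scale k (x : U) :
  lquot_scale k (\pi_lquot x) = \pi_lquot (k *: x).
Proof.
apply/lquot_eqP; rewrite -scalerBr rpredZ//.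
by apply/lquot_eqP; rewrite reprK.
Qed.

Fact lquot_scalerA a b v :
  lquot_scale a (lquot_scale b v) = lquot_scale (a * b) v.
Proof. by elim/lquotW: v => v; rewrite !pi_lquot_scale scalerA. Qed.
Fact lquot_scale1r : left_id 1 lquot_scale.
Proof. by move=> v; elim/lquotW: v => v; rewrite !pi_lquot_scale scale1r. Qed.
Fact lquot_scalerDr : right_distributive lquot_scale +%R.
Proof.
move=> k x y; elim/lquotW: x => x; elim/lquotW: y => y.
by rewrite -pi_lquotD !pi_lquot_scale scalerDr pi_lquotD.
Qed.
Fact lquot_scalerDl v : {morph lquot_scale^~ v : a b / a + b}.
Proof.
move=> a b; elim/lquotW: v => v.
by rewrite !pi_lquot_scale scalerDl pi_lquotD.
Qed.
HB.instance Definition _ := GRing.Zmodule_isLmodule.Build K lquot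
  lquot_scalerA lquot_scale1r lquot_scalerDr lquot_scalerDl.

Lemma pi_lquotZ k (x : U) : \pi_lquot (k *: x) = k *: \pi_lquot x.
Proof. by rewrite -pi_lquot_scale. Qed.
Lemma pi_lquot_linear k (x y : U) :
  \pi_lquot (k *: x + y) = k *: \pi_lquot x + \pi_lquot y.
Proof. by rewrite pi_lquotD pi_lquotZ. Qed.
End QuotientModule.

(* The coefficient at x0^p x1^q x2^r of a formal series
   in U[[x0^{+-1}, x1^{+-1}, x2^{+-1}]]. *)
Definition fseries3 (U : Type) := int -> int -> int -> U.

Section FormalCalculus.
Variable K : numFieldType.

Definition binz (n : int) (i : nat) : K :=
  (\prod_(j < i) (n - j%:Z)%:~R) / i`!%:R.

(* x0^{-1} delta((x1 - x2) / x0) = \sum_n x0^{-n-1} (x1 - x2)^n, each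
   (x1 - x2)^n being expanded in nonnegative powers of x2. *)
Definition fdelta : fseries3 K := fun p q r =>
  if r is Posz i then
    if p + q + r == -1 then (-1) ^+ i * binz (- p - 1) i else 0
  else 0.

(* Meaningful when every coefficient is given by a finite sum, the finitely
   supported sum being 0 otherwise. *)
Definition fmul (U : lmodType K) (s : fseries3 K) (g : fseries3 U) :
    fseries3 U := fun p q r =>
  \sum_(k \in [set: int * int * int])
    s k.1.1 k.1.2 k.2 *: g (p - k.1.1) (q - k.1.2) (r - k.2).
End FormalCalculus.
Arguments fdelta : simpl never.

Reserved Notation "u \_( n ) v"
  (at level 35, v at level 35, right associativity, format "u  \_( n )  v").

Definition va_jacobi (K : numFieldType) (U : lmodType K)
    (op : U -> int -> U -> U) :=
  forall (u v w : U) (p q r : int),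
    fmul (@fdelta K)
      (fun a b c => if a == 0 then op u (- b - 1) (op v (- c - 1) w) else 0)
      p q r
    (* x0^{-1} delta((x2 - x1) / (- x0)) *)
    - fmul (fun a b c => (-1) ^ (a + 1) * fdelta K a c b)
      (fun a b c => if a == 0 then op v (- c - 1) (op u (- b - 1) w) else 0)
      p q r
    (* x2^{-1} delta((x1 - x0) / x2) *)
    = fmul (fun a b c => fdelta K c b a)
      (fun a b c => if b == 0 then op (op u (- a - 1) v) (- c - 1) w else 0)
      p q r.

(* [vop u n v] is u_n v, the coefficient at x^{-n-1} of Y(u, x) v. *)
Record vertexAlgebra (K : numFieldType) := VertexAlgebra {
  va_sort :> lmodType K;
  vop : va_sort -> int -> va_sort -> va_sort;
  vac : va_sort;
  vop_linearl : forall n v, linear (fun u => vop u n v);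
  vop_linearr : forall u n, linear (vop u n);
  vop_truncation : forall u v, exists N, forall n, N <= n -> vop u n v = 0;
  vop_vacl : forall n v, vop vac n v = if n == -1 then v else 0;
  vop_vacr_reg : forall v n, 0 <= n -> vop v n vac = 0;
  vop_vacr : forall v, vop v (-1) vac = v;
  vop_jacobi : va_jacobi vop
}.

Arguments vac {K} V : rename.
Notation "u \_( n ) v" := (vop u n v) : ring_scope.

Section VertexAlgebras.
Variables (K : numFieldType) (V : vertexAlgebra K).
Implicit Types (S I U W : set V).

Definition Dop (v : V) : V := v \_(-2) vac V.

Definition vertex_subalgebra S :=
  [/\ subspace S, S (vac V) & forall u n v, S u -> S v -> S (u \_(n) v)].

Definition generated_by S := smallest vertex_subalgebra S = setT.

Definition va_ideal I :=
  subspace I /\ forall v w n, I w -> I (v \_(n) w) /\ I (w \_(n) v).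

Definition ideal_generated S : set V := smallest va_ideal S.

Definition va_simple := forall I, va_ideal I -> I = [set 0] \/ I = setT.

Definition va_decomposable :=
  exists U W,
    [/\ va_ideal U /\ va_ideal W,
        (U <> [set 0] /\ U <> setT) /\ (W <> [set 0] /\ W <> setT),
        U `&` W = [set 0] &
        forall v, exists u w, [/\ U u, W w & v = u + w]].

Definition va_indecomposable := ~ va_decomposable.

(* V_(j) for an arbitrary integer degree j. *)
Definition homogeneous (gr : nat -> set V) (j : int) : set V :=
  if j is Posz n then gr n else [set 0].

Record Ngrading := NatGrading {
  gr :> nat -> submodClosed V;
  gr_span : forall v, exists N (x : nat -> V),
    (forall n, x n \in gr n) /\ v = \sum_(n < N) x n;
  gr_indep : forall N (x : nat -> V),
    (forall n, x n \in gr n) -> \sum_(n < N) x n = 0 ->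
    forall n, (n < N)%N -> x n = 0;
  gr_vac : vac V \in gr 0%N;
  gr_vop : forall (k n : nat) (m : int) u v, u \in gr k -> v \in gr n ->
    homogeneous (fun i => [set` gr i]) (k%:Z + n%:Z - m - 1) (u \_(m) v)
}.
End VertexAlgebras.

Section VertexAlgebraTheory.
Variables (K : numFieldType) (V : vertexAlgebra K).
Implicit Types (u v w : V) (l m n : int).

Lemma vopDl u v n w : (u + v) \_(n) w = u \_(n) w + v \_(n) w.
Proof. by have := vop_linearl n w 1 u v; rewrite !scale1r. Qed.
Lemma vopDr u n v w : u \_(n) (v + w) = u \_(n) v + u \_(n) w.
Proof. by have := vop_linearr u n 1 v w; rewrite !scale1r. Qed.
Lemma vop0l n w : (0 : V) \_(n) w = 0.
Proof. by apply: (addrI ((0 : V) \_(n) w)); rewrite -vopDl !addr0. Qed.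
Lemma vop0r u n : u \_(n) (0 : V) = 0.
Proof. by apply: (addrI (u \_(n) (0 : V))); rewrite -vopDr !addr0. Qed.
Lemma vopZl k u n w : (k *: u) \_(n) w = k *: u \_(n) w.
Proof. by have := vop_linearl n w k u 0; rewrite vop0l !addr0. Qed.
Lemma vopZr k u n w : u \_(n) (k *: w) = k *: u \_(n) w.
Proof. by have := vop_linearr u n k w 0; rewrite vop0r !addr0. Qed.
Lemma vopNl u n w : (- u) \_(n) w = - u \_(n) w.
Proof. by rewrite -scaleN1r vopZl scaleN1r. Qed.
Lemma vopNr u n w : u \_(n) (- w) = - u \_(n) w.
Proof. by rewrite -scaleN1r vopZr scaleN1r. Qed.

Lemma fsum_nat (U : lmodType K) (N : nat) (T : choiceType) (h : nat -> T)
    (F : T -> U) : injective h ->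
  (forall k, F k <> 0 -> exists2 i : nat, (i < N)%N & k = h i) ->
  \sum_(k \in [set: T]) F k = \sum_(i < N) F (h i).
Proof.
move=> h_inj Fh; rewrite (@fsbigE _ _ _ _ _ (map h (iota 0 N)))//.
- rewrite big_map (eq_bigl xpredT) => [|i]; last by rewrite in_setT.
  by rewrite -(big_mkord xpredT (fun i => F (h i))) /index_iota subn0.
- by rewrite map_inj_uniq// iota_uniq.
- move=> k _ kh; apply: contrapT => /Fh[i iN ki]; move/negP: kh; apply.
  by rewrite ki map_f// mem_iota.
Qed.

Lemma fdelta_neq0 p q r : fdelta K p q r <> 0 ->
  exists2 i : nat, r = i & q = - 1 - p - i%:Z.
Proof.
case: r => [i|//]; rewrite /fdelta; case: eqP => // e _; exists i => //.
by rewrite -e; ring.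
Qed.

Lemma fdeltaE (p q : int) (i : nat) : q = - 1 - p - i%:Z ->
  fdelta K p q i = (-1) ^+ i * binz K (- p - 1) i.
Proof. by move=> ->; rewrite /fdelta ifT//; apply/eqP; ring. Qed.

(* The coefficient of the Jacobi identity at x0^{-l-1} x1^{-m-1} x2^{-n-1}. *)
Lemma jacobi_fin (N : nat) u v w l m n :
  (forall i : nat, (N <= i)%N -> v \_(n + i) w = 0) ->
  (forall i : nat, (N <= i)%N -> u \_(m + i) w = 0) ->
  (forall i : nat, (N <= i)%N -> u \_(l + i) v = 0) ->
  \sum_(i < N) ((-1) ^+ i * binz K l i) *: u \_(l + m - i%:Z) (v \_(n + i) w)
  - \sum_(i < N) ((-1) ^ (- l) * ((-1) ^+ i * binz K l i)) *:
      v \_(n + l - i%:Z) (u \_(m + i) w)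
  = \sum_(i < N) ((-1) ^+ i * binz K (i%:Z - m - 1) i) *:
      (u \_(l + i) v) \_(m + n - i%:Z) w.
Proof.
move=> vw0 uw0 uv0.
have := vop_jacobi u v w (- l - 1) (- m - 1) (- n - 1).
rewrite /fmul (@fsum_nat _ N _ (fun i : nat => (- l - 1, l - i%:Z, i%:Z))); first last.
- move=> [[k0 k1] k2] /=; case: eqP => [e|_]; last by rewrite scaler0.
  move=> F0; have [|i ri qi] := @fdelta_neq0 k0 k1 k2.
    by move=> d0; apply: F0; rewrite d0 scale0r.
  exists i; last by congr (_, _, _) => //; lia.
  rewrite ltnNge; apply/negP => Ni; apply: F0.
  have -> : - (- n - 1 - k2) - 1 = n + i by lia.
  by rewrite vw0// vop0r scaler0.
- by move=> i j [].
rewrite (@fsum_nat _ N _ (fun i : nat => (- l - 1, i%:Z, l - i%:Z))); first last.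
- move=> [[k0 k1] k2] /=; case: eqP => [e|_]; last by rewrite scaler0.
  move=> F0; have [|i ri qi] := @fdelta_neq0 k0 k2 k1.
    by move=> d0; apply: F0; rewrite d0 mulr0 scale0r.
  exists i; last by congr (_, _, _) => //; lia.
  rewrite ltnNge; apply/negP => Ni; apply: F0.
  have -> : - (- m - 1 - k1) - 1 = m + i by lia.
  by rewrite uw0// vop0r scaler0.
- by move=> i j [].
rewrite (@fsum_nat _ N _ (fun i : nat => (i%:Z, - m - 1, m - i%:Z))); first last.
- move=> [[k0 k1] k2] /=; case: eqP => [e|_]; last by rewrite scaler0.
  move=> F0; have [|i ri qi] := @fdelta_neq0 k2 k1 k0.
    by move=> d0; apply: F0; rewrite d0 scale0r.
  exists i; last by congr (_, _, _) => //; lia.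
  rewrite ltnNge; apply/negP => Ni; apply: F0.
  have -> : - (- l - 1 - k0) - 1 = l + i by lia.
  by rewrite uv0// vop0l scaler0.
- by move=> i j [].
move=> J; apply: etrans (etrans J _); first congr (_ - _).
- apply: eq_bigr => i _ /=; rewrite subrr eqxx fdeltaE; last by lia.
  by congr ((_ * binz K _ _) *: vop _ _ (vop _ _ _)); lia.
- apply: eq_bigr => i _ /=; rewrite subrr eqxx fdeltaE; last by lia.
  by congr ((_ ^ _ * (_ * binz K _ _)) *: vop _ _ (vop _ _ _)); lia.
- apply: eq_bigr => i _ /=; rewrite subrr eqxx fdeltaE; last by lia.
  by congr ((_ * binz K _ _) *: vop (vop _ _ _) _ _); lia.
Qed.
End VertexAlgebraTheory.
Section Grading.
Variables (K : numFieldType) (V : vertexAlgebra K).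
Implicit Types (u v w : V) (l m n : int).

Lemma binz0 n : binz K n 0 = 1.
Proof. by rewrite /binz big_ord0 divr1. Qed.

Lemma binz_eq0 (k i : nat) : (k < i)%N -> binz K k i = 0.
Proof.
move=> ki; rewrite /binz (bigD1 (Ordinal ki)) //= subrr.
by rewrite mulr0z !mul0r.
Qed.

Lemma sign_binzN1 (i : nat) : (-1) ^+ i * binz K (-1) i = 1.
Proof.
have -> : binz K (-1) i = (-1) ^+ i; last first.
  by rewrite -exprD addnn -mul2n exprM sqrrN !expr1n.
have i0 : (i`!%:R : K) != 0 by rewrite pnatr_eq0 -lt0n fact_gt0.
apply: (canLR (mulfK i0)); elim: i {i0} => [|i IH].
  by rewrite big_ord0 mulr1.
rewrite big_ord_recr /= IH factS natrM exprS.
rewrite rmorphB /= rmorphN /= rmorph1.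
have -> : (i%:Z%:~R : K) = i%:R by [].
by rewrite -natr1; ring.
Qed.

Lemma vop_trunc u n v :
  exists N : nat, forall i : nat, (N <= i)%N -> u \_(n + i) v = 0.
Proof.
have [M uv0] := vop_truncation u v.
by exists `|M - n|%N => i Ni; apply: uv0; lia.
Qed.

Lemma sum_shrink (U : nmodType) (N M : nat) (F : nat -> U) : (N <= M)%N ->
  (forall i, (N <= i)%N -> F i = 0) -> \sum_(i < M) F i = \sum_(i < N) F i.
Proof.
move=> NM F0; rewrite -!(big_mkord xpredT) (big_cat_nat _ NM)//=.
rewrite [X in _ + X]big1_seq ?addr0// => i /=.
by rewrite mem_index_iota => /andP[/F0].
Qed.

Lemma sum_first (U : nmodType) (M : nat) (F : 'I_M.+1 -> U) :
  (forall i : 'I_M.+1, (0 < i)%N -> F i = 0) -> \sum_(i < M.+1) F i = F ord0.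
Proof. by move=> F0; rewrite big_ord_recl big1 ?addr0// => i _; rewrite F0. Qed.

Lemma vop_commutator (N : nat) u v w m n :
  (forall i : nat, (N <= i)%N -> u \_(i%:Z) v = 0) ->
  u \_(m) (v \_(n) w) - v \_(n) (u \_(m) w) =
  \sum_(i < N) ((-1) ^+ i * binz K (i%:Z - m - 1) i) *:
      (u \_(i%:Z) v) \_(m + n - i%:Z) w.
Proof.
move=> uv0.
have [N1 vw0] := vop_trunc v n w; have [N2 uw0] := vop_trunc u m w.
pose M := (N1 + N2 + N).+1.
have := @jacobi_fin _ V M u v w 0 m n.
rewrite [X in X - _](sum_first (M := (N1 + N2 + N)%N)); last first.
  by move=> i i0; rewrite binz_eq0// mulr0 scale0r.
rewrite [X in _ - X](sum_first (M := (N1 + N2 + N)%N)); last first.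
  by move=> i i0; rewrite binz_eq0// !mulr0 scale0r.
rewrite (@sum_shrink _ N M (fun i : nat => ((-1) ^+ i * binz K (i%:Z - m - 1) i) *:
      (u \_(0 + i%:Z) v) \_(m + n - i%:Z) w)); first last.
- by move=> i Ni; rewrite add0r uv0// vop0l scaler0.
- by rewrite /M; lia.
rewrite /= oppr0 !expr0z !binz0 !mul1r !scale1r !subr0 !add0r.
move=> ->; last 1 first.
- by move=> i Mi; rewrite add0r uv0//; lia.
- by apply: eq_bigr => i _; rewrite add0r.
- by move=> i Mi; apply: vw0; lia.
- by move=> i Mi; apply: uw0; lia.
Qed.

Lemma vop_iterate (N : nat) u v w l n :
  (forall i : nat, (N <= i)%N -> v \_(n + i%:Z) w = 0) ->
  (forall i : nat, (N <= i)%N -> u \_(i%:Z) w = 0) ->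
  (u \_(l) v) \_(n) w =
  \sum_(i < N) ((-1) ^+ i * binz K l i) *: u \_(l - i%:Z) (v \_(n + i) w)
  - \sum_(i < N) ((-1) ^ (- l) * ((-1) ^+ i * binz K l i)) *:
      v \_(n + l - i%:Z) (u \_(i%:Z) w).
Proof.
move=> vw0 uw0; have [N1 uv0] := vop_trunc u l v.
pose M := (N1 + N).+1.
have h1 i : (M <= i)%N -> v \_(n + i%:Z) w = 0 by move=> Mi; apply: vw0; lia.
have h2 i : (M <= i)%N -> u \_(0 + i%:Z) w = 0.
  by move=> Mi; rewrite add0r; apply: uw0; lia.
have h3 i : (M <= i)%N -> u \_(l + i%:Z) v = 0 by move=> Mi; apply: uv0; lia.
have := jacobi_fin h1 h2 h3.
rewrite [X in _ = X](sum_first (M := (N1 + N)%N)); last first.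
  move=> [[//|i] /= iM] _; have -> : i.+1%:Z - 0 - 1 = i%:Z by lia.
  by rewrite binz_eq0// mulr0 scale0r.
rewrite (@sum_shrink _ N M (fun i : nat => ((-1) ^+ i * binz K l i) *:
  u \_(l + 0 - i%:Z) (v \_(n + i) w))); first last.
- by move=> i Ni; rewrite vw0// vop0r scaler0.
- by rewrite /M; lia.
rewrite (@sum_shrink _ N M (fun i : nat => ((-1) ^ (- l) * ((-1) ^+ i * binz K l i)) *:
      v \_(n + l - i%:Z) (u \_(0 + i%:Z) w))); first last.
- by move=> i Ni; rewrite add0r uw0// vop0r scaler0.
- by rewrite /M; lia.
rewrite /= binz0 mul1r scale1r add0r subr0 addr0 => <-.
by congr (_ - _); apply: eq_bigr => i _; rewrite ?addr0 ?add0r.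
Qed.

Lemma vop0_derivation u v w n :
  u \_(0) (v \_(n) w) = (u \_(0) v) \_(n) w + v \_(n) (u \_(0) w).
Proof.
have [N uv0] := vop_trunc u 0 v; apply/eqP; rewrite -subr_eq; apply/eqP.
rewrite (@vop_commutator N.+1)//; last first.
  by move=> i Ni; rewrite -[i%:Z]add0r; apply: uv0; lia.
rewrite big_ord_recl /= binz0 mul1r scale1r add0r subr0.
rewrite big1 ?addr0// => i _; rewrite /bump /= add1n.
have -> : i.+1%:Z - 0 - 1 = i%:Z by lia.
by rewrite binz_eq0// mulr0 scale0r.
Qed.

Lemma Dop_vop0 v w : (Dop v) \_(0) w = 0.
Proof.
have [N vw0] := vop_trunc v 0 w.
rewrite /Dop (@vop_iterate N); first last.
- by move=> i /vw0; rewrite add0r.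
- by move=> i _; rewrite vop_vacl.
rewrite [X in X - _]big1 => [|i _]; last by rewrite vop_vacl /= vop0r scaler0.
rewrite big1 ?subr0// => i _; rewrite vop_vacl.
by case: eqP => [|_]; [lia|rewrite scaler0].
Qed.

Variable G : Ngrading V.

Lemma gr_vop_lt0 (k n : nat) m u v : u \in G k -> v \in G n ->
  k%:Z + n%:Z - m - 1 < 0 -> u \_(m) v = 0.
Proof. by move=> uk vn; have := gr_vop m uk vn; case: (_ - _) => //. Qed.

Lemma gr_vop_in (j k n : nat) m u v : u \in G k -> v \in G n ->
  k%:Z + n%:Z - m - 1 = j -> u \_(m) v \in G j.
Proof. by move=> uk vn e; have := gr_vop m uk vn; rewrite e. Qed.

Lemma gr0_commute a b m n w : a \in G 0%N -> b \in G 0%N ->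
  a \_(m) (b \_(n) w) = b \_(n) (a \_(m) w).
Proof.
move=> a0 b0.
apply/eqP; rewrite -subr_eq0 (@vop_commutator 0) ?big_ord0//.
by move=> i _; apply: (gr_vop_lt0 a0 b0); lia.
Qed.

Lemma gr0_vopA a b w : a \in G 0%N -> b \in G 0%N ->
  w \in G 0%N \/ w \in G 1%N ->
  (a \_(-1) b) \_(-1) w =
  a \_(-1) (b \_(-1) w) + a \_(-2) (b \_(0) w) + b \_(-2) (a \_(0) w).
Proof.
move=> a0 b0 w01; have h x (i : nat) : x \in G 0%N -> (0 < i)%N -> x \_(i%:Z) w = 0.
  by move=> x0 i0; case: w01 => w01; apply: (gr_vop_lt0 x0 w01); lia.
rewrite (@vop_iterate 2); first last.
- by move=> i i2; apply: h => //; lia.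
- move=> i i2; have -> : -1 + i%:Z = (i.-1)%:Z by lia.
  by apply: h => //; lia.
rewrite !big_ord_recr !big_ord0 /= ?add0r !sign_binzN1 ?mulr1.
by rewrite opprK !subr0 [a \_(1) w]h// vop0r !scaler0 addr0 !scale1r expr1z scaleN1r opprK.
Qed.

Lemma gr1_vop_gr0 a u w : a \in G 0%N -> u \in G 1%N -> w \in G 0%N ->
  (a \_(-1) u) \_(0) w = a \_(-1) (u \_(0) w).
Proof.
move=> a0 u1 w0; rewrite (@vop_iterate 1); first last.
- by move=> i _; apply: (gr_vop_lt0 a0 w0); lia.
- by move=> i i1; apply: (gr_vop_lt0 u1 w0); lia.
rewrite !big_ord1 /= sign_binzN1 ?mulr1 ?scale1r ?subr0 ?add0r.
by rewrite (gr_vop_lt0 a0 w0) ?vop0r ?scaler0 ?subr0//; lia.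
Qed.

Lemma gr1_skew u v : u \in G 1%N -> v \in G 1%N ->
  u \_(0) v + v \_(0) u = Dop (u \_(1) v).
Proof.
move=> u1 v1; have h (i : nat) : (2 <= i)%N -> u \_(i%:Z) v = 0.
  by move=> i2; apply: (gr_vop_lt0 u1 v1); lia.
have := @vop_commutator 2 u v (vac V) (-1) 0 h.
rewrite vop_vacr_reg// vop0r vop_vacr sub0r.
rewrite !big_ord_recr big_ord0 /= add0r binz0 mul1r scale1r.
have -> : -1 + 0 - 0 = -1 :> int by [].
have -> : -1 + 0 - 1 = -2 :> int by [].
have -> : binz K (1%:Z - -1 - 1) 1 = 1.
  by rewrite /binz big_ord1 /= divr1.
rewrite vop_vacr expr1 mulr1 scaleN1r => e.
by rewrite /Dop -[v \_(0) u]opprK e opprB addrC subrK.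
Qed.

Lemma gr0_vopN2 a b : a \in G 0%N -> b \in G 0%N ->
  a \_(-2) b = b \_(-1) (Dop a).
Proof.
move=> a0 b0; rewrite /Dop -[in LHS](vop_vacr b); apply/eqP; rewrite -subr_eq0.
rewrite (@vop_commutator 0) ?big_ord0// => i _.
by apply: (gr_vop_lt0 a0 b0); lia.
Qed.

Lemma vop0_Dop u a : u \_(0) (Dop a) = Dop (u \_(0) a).
Proof. by rewrite /Dop vop0_derivation (vop_vacr_reg u)// vop0r addr0. Qed.

Lemma gr0_Dop a b : a \in G 0%N -> b \in G 0%N -> a \_(0) (Dop b) = 0.
Proof.
move=> a0 b0; rewrite /Dop vop0_derivation (vop_vacr_reg a)// vop0r addr0.
by rewrite (gr_vop_lt0 a0 b0) ?vop0l//; lia.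
Qed.
End Grading.

Section Homogeneous.
Variables (K : numFieldType) (V : vertexAlgebra K) (G : Ngrading V) (n : nat).

Record homog := Homog { homog_val :> V; homog_in : homog_val \in G n }.

HB.instance Definition _ := [isSub for homog_val].
HB.instance Definition _ := [Choice of homog by <:].
HB.instance Definition _ := [SubChoice_isSubLmodule of homog by <:].
End Homogeneous.

Section LowDegreeStructures.
Variables (K : numFieldType) (V : vertexAlgebra K) (G : Ngrading V).

Notation V0 := (homog G 0%N).
Notation V1 := (homog G 1%N).

Fact homog_vop00_in (a b : V0) : (a : V) \_(-1) (b : V) \in G 0%N.
Proof. by apply: (gr_vop_in (homog_in a) (homog_in b)). Qed.
Definition gr0_mul (a b : V0) : V0 := Homog (homog_vop00_in a b).

Fact homog_vop01_in (a : V0) (u : V1) : (a : V) \_(-1) (u : V) \in G 1%N.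
Proof. by apply: (gr_vop_in (homog_in a) (homog_in u)). Qed.
Definition gr1_scale (a : V0) (u : V1) : V1 := Homog (homog_vop01_in a u).

Fact homog_vop10_in (u : V1) (a : V0) : (u : V) \_(0) (a : V) \in G 0%N.
Proof. by apply: (gr_vop_in (homog_in u) (homog_in a)). Qed.
Definition gr1_act (u : V1) (a : V0) : V0 := Homog (homog_vop10_in u a).

Fact homog_vop11_in (u v : V1) : (u : V) \_(0) (v : V) \in G 1%N.
Proof. by apply: (gr_vop_in (homog_in u) (homog_in v)). Qed.
Definition gr1_bracket (u v : V1) : V1 := Homog (homog_vop11_in u v).

Fact gr0_mulC : commutative gr0_mul.
Proof.
move=> a b; apply: val_inj => /=; rewrite -[in LHS](vop_vacr (b : V)).
by rewrite (gr0_commute _ _ _ (homog_in a) (homog_in b)) vop_vacr.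
Qed.
Fact gr0_vop00 (a b : V0) : (a : V) \_(0) (b : V) = 0.
Proof. by apply: (gr_vop_lt0 (homog_in a) (homog_in b)). Qed.
Fact gr0_mulA : associative gr0_mul.
Proof.
move=> a b c; apply: val_inj => /=.
rewrite (gr0_vopA (homog_in a) (homog_in b)); last by left; apply: homog_in.
by rewrite !gr0_vop00 !vop0r !addr0.
Qed.
Fact gr0_mul1 : left_id (Homog (gr_vac G)) gr0_mul.
Proof. by move=> a; apply: val_inj; rewrite /= vop_vacl. Qed.
Fact gr0_mul_linear a : linear (gr0_mul a).
Proof. by move=> k b c; apply: val_inj; rewrite /= vopDr vopZr. Qed.

Definition gr0_algebra : commAlgebra K :=
  CommAlgebra gr0_mulA gr0_mulC gr0_mul1 gr0_mul_linear.

Definition rad_form : set V :=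
  [set u | u \in G 1%N /\ forall b, b \in G 1%N -> u \_(1) b = 0].

Definition ann_gr0 : set V :=
  [set b | b \in G 1%N /\ forall a, a \in G 0%N -> b \_(0) a = 0].

Definition gr0D : set V :=
  linear_span [set x | exists a a', [/\ a \in G 0%N, a' \in G 0%N &
                                 x = a \_(-1) Dop a']].

(* Conditions on a subspace S of V_(1) under which u_0 v, a_{-1} u and u_0 a
   induce a Lie V_(0)-algebroid structure on V_(1) / S. Both Ann(V_(0)) and
   V_(0) D(V_(0)) satisfy them. *)
Record algebroid_kernel := AlgebroidKernel {
  ak_set : set V;
  ak_subspace : subspace ak_set;
  ak_gr0D : gr0D `<=` ak_set;
  ak_ann : ak_set `<=` ann_gr0;
  ak_bracket : forall u x, u \in G 1%N -> ak_set x -> ak_set (u \_(0) x);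
  ak_scale : forall a x, a \in G 0%N -> ak_set x -> ak_set (a \_(-1) x)
}.

Section Quotient.
Variable S : algebroid_kernel.

Definition ak_pred : {pred V1} := [pred u : V1 | (u : V) \in ak_set S].

Fact ak_pred_closed : submod_closed ak_pred.
Proof.
have [S0 Slin] := ak_subspace S.
by split=> [|k u v]; [exact: S0|exact: Slin].
Qed.
HB.instance Definition _ := GRing.isSubmodClosed.Build K V1 ak_pred ak_pred_closed.

Lemma ak_predP (u : V1) : u \in ak_pred <-> ak_set S (u : V).
Proof. by split=> [/set_mem|/mem_set]. Qed.

Definition gr1_quot : lmodType K := lquot ak_pred.
Notation Q := gr1_quot.
Notation "\cl u" := (\pi_(lquot ak_pred) u : Q) (at level 10).

Lemma clP (u v : V1) : \cl u = \cl v <-> ak_set S ((u : V) - (v : V)).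
Proof. by rewrite lquot_eqP ak_predP. Qed.

Lemma cl_repr (u : V1) : ak_set S (homog_val (repr (\cl u)) - (u : V)).
Proof. by apply/clP; rewrite reprK. Qed.

Lemma akD x y : ak_set S x -> ak_set S y -> ak_set S (x + y).
Proof.
case/subspaceP: (ak_subspace S) => _ Slin Sx Sy.
by have := Slin 1 x y Sx Sy; rewrite scale1r.
Qed.
Lemma akN x : ak_set S x -> ak_set S (- x).
Proof.
case/subspaceP: (ak_subspace S) => S0 Slin Sx.
by have := Slin (-1) x 0 Sx S0; rewrite scaleN1r addr0.
Qed.

Lemma ak_Dop a : a \in G 0%N -> ak_set S (Dop a).
Proof.
move=> a0; apply: ak_gr0D; apply: sub_gen_smallest.
by exists (vac V), a; split=> //; [exact: gr_vac|rewrite vop_vacl].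
Qed.

Lemma ak_bracketl u x : u \in G 1%N -> ak_set S x -> ak_set S (x \_(0) u).
Proof.
move=> u1 Sx; have [x1 _] := ak_ann Sx.
have -> : x \_(0) u = Dop (u \_(1) x) - u \_(0) x.
  by rewrite -(gr1_skew u1 x1) addrC addKr.
apply: akD; last exact/akN/ak_bracket.
by apply: ak_Dop; apply: (gr_vop_in u1 x1).
Qed.

Definition gr1q_bracket (x y : Q) : Q := \cl (gr1_bracket (repr x) (repr y)).
Definition gr1q_scale (a : V0) (x : Q) : Q := \cl (gr1_scale a (repr x)).
Definition gr1q_act (x : Q) (a : V0) : V0 := gr1_act (repr x) a.

Lemma gr1q_bracketE u v : gr1q_bracket (\cl u) (\cl v) = \cl (gr1_bracket u v).
Proof.
apply/clP => /=; set u' : V1 := repr _; set v' : V1 := repr _.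
have -> : (u' : V) \_(0) (v' : V) - (u : V) \_(0) (v : V) =
  ((u' : V) - (u : V)) \_(0) (v' : V) + (u : V) \_(0) ((v' : V) - (v : V)).
  by rewrite vopDl vopNl vopDr vopNr addrA subrK.
apply: akD; first by apply: ak_bracketl; [exact: homog_in|exact: cl_repr].
by apply: ak_bracket; [exact: homog_in|exact: cl_repr].
Qed.

Lemma gr1q_scaleE a u : gr1q_scale a (\cl u) = \cl (gr1_scale a u).
Proof.
apply/clP => /=; rewrite -vopNr -vopDr.
by apply: ak_scale; [exact: homog_in|exact: cl_repr].
Qed.

Lemma gr1q_actE u a : gr1q_act (\cl u) a = gr1_act u a.
Proof.
apply: val_inj => /=; apply/eqP; rewrite -subr_eq0 -vopNl -vopDl; apply/eqP.
by have [_] := ak_ann (cl_repr u); apply; exact: homog_in.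
Qed.

Lemma clW (P : Q -> Prop) : (forall u, P (\cl u)) -> forall x, P x.
Proof. exact: lquotW. Qed.

Lemma cl_linear k u v : k *: \cl u + \cl v = \cl (k *: u + v).
Proof. by rewrite -pi_lquot_linear. Qed.
Lemma clD u v : \cl u + \cl v = \cl (u + v).
Proof. by rewrite -pi_lquotD. Qed.
Lemma clB u v : \cl u - \cl v = \cl (u - v).
Proof. by rewrite pi_lquotD pi_lquotN. Qed.
Lemma cl0 : (0 : Q) = \cl 0.
Proof. by rewrite pi_lquot0. Qed.

Fact gr1q_bracket_linearl y : linear (gr1q_bracket^~ y).
Proof.
move=> k x z; elim/clW: x => x; elim/clW: y => y; elim/clW: z => z.
rewrite /= cl_linear !gr1q_bracketE cl_linear; congr (\cl _).
by apply: val_inj; rewrite /= vopDl vopZl.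
Qed.
Fact gr1q_bracket_linearr x : linear (gr1q_bracket x).
Proof.
move=> k y z; elim/clW: x => x; elim/clW: y => y; elim/clW: z => z.
rewrite /= cl_linear !gr1q_bracketE cl_linear; congr (\cl _).
by apply: val_inj; rewrite /= vopDr vopZr.
Qed.
Fact gr1q_bracket_alt x : gr1q_bracket x x = 0.
Proof.
elim/clW: x => x; rewrite gr1q_bracketE cl0; apply/clP; rewrite /= subr0.
have e := gr1_skew (homog_in x) (homog_in x).
have -> : (x : V) \_(0) (x : V) = 2%:R^-1 *: Dop ((x : V) \_(1) (x : V)).
  by rewrite -e -mulr2n -scaler_nat scalerA mulVf ?scale1r// pnatr_eq0.
have [S0 Slin] := (subspaceP _).1 (ak_subspace S).
rewrite -[_ *: _]addr0; apply: Slin => //.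
by apply: ak_Dop; apply: (gr_vop_in (homog_in x) (homog_in x)).
Qed.
Fact gr1q_bracket_jacobi x y z :
  gr1q_bracket x (gr1q_bracket y z) =
  gr1q_bracket (gr1q_bracket x y) z + gr1q_bracket y (gr1q_bracket x z).
Proof.
elim/clW: x => x; elim/clW: y => y; elim/clW: z => z.
rewrite !gr1q_bracketE clD; congr (\cl _).
by apply: val_inj; rewrite /= vop0_derivation.
Qed.
Fact gr1q_scale_linearl x : linear (gr1q_scale^~ x).
Proof.
move=> k a b; elim/clW: x => x; rewrite /= !gr1q_scaleE cl_linear.
by congr (\cl _); apply: val_inj; rewrite /= vopDl vopZl.
Qed.
Fact gr1q_scale_linearr a : linear (gr1q_scale a).
Proof.
move=> k x y; elim/clW: x => x; elim/clW: y => y.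
rewrite cl_linear !gr1q_scaleE cl_linear; congr (\cl _).
by apply: val_inj; rewrite /= vopDr vopZr.
Qed.
Fact gr1q_scale1 x : gr1q_scale (ca_one gr0_algebra) x = x.
Proof.
elim/clW: x => x; rewrite gr1q_scaleE; congr (\cl _).
by apply: val_inj; rewrite /= vop_vacl.
Qed.
Fact gr1q_scaleA a b x :
  gr1q_scale (gr0_mul a b) x = gr1q_scale a (gr1q_scale b x).
Proof.
elim/clW: x => x; rewrite !gr1q_scaleE; apply/clP => /=.
rewrite (gr0_vopA (homog_in a) (homog_in b)); last by right; apply: homog_in.
have h (c d : V0) : ak_set S ((c : V) \_(-2) ((d : V) \_(0) (x : V))).
  have d0 : (d : V) \_(0) (x : V) \in G 0%N.
    by apply: (gr_vop_in (homog_in d) (homog_in x)).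
  rewrite (gr0_vopN2 (homog_in c) d0).
  apply: ak_scale => //; exact/ak_Dop/homog_in.
by rewrite -2!addrA [X in _ + X]addrA addrC addrNK; apply: akD; exact: h.
Qed.
Fact gr1q_act_linearl a : linear (gr1q_act^~ a).
Proof.
move=> k x y; elim/clW: x => x; elim/clW: y => y.
rewrite /= cl_linear !gr1q_actE.
by apply: val_inj; rewrite /= vopDl vopZl.
Qed.
Fact gr1q_act_linearr x : linear (gr1q_act x).
Proof. by move=> k a b; apply: val_inj; rewrite /= vopDr vopZr. Qed.
Fact gr1q_act_bracket x y a :
  gr1q_act (gr1q_bracket x y) a =
  gr1q_act x (gr1q_act y a) - gr1q_act y (gr1q_act x a).
Proof.
elim/clW: x => x; elim/clW: y => y; rewrite gr1q_bracketE !gr1q_actE.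
by apply: val_inj; rewrite /= (vop0_derivation (x : V)) addrK.
Qed.
Fact gr1q_act_derivation x a b :
  gr1q_act x (gr0_mul a b) =
  gr0_mul (gr1q_act x a) b + gr0_mul a (gr1q_act x b).
Proof. by apply: val_inj; rewrite /= vop0_derivation. Qed.
Fact gr1q_bracket_scale x y a :
  gr1q_bracket x (gr1q_scale a y) =
  gr1q_scale a (gr1q_bracket x y) + gr1q_scale (gr1q_act x a) y.
Proof.
elim/clW: x => x; elim/clW: y => y.
rewrite gr1q_actE !(gr1q_scaleE, gr1q_bracketE) clD; congr (\cl _).
by apply: val_inj; rewrite /= vop0_derivation addrC.
Qed.
Fact gr1q_act_scale a x b :
  gr0_mul a (gr1q_act x b) = gr1q_act (gr1q_scale a x) b.
Proof.
elim/clW: x => x; rewrite gr1q_scaleE !gr1q_actE; apply: val_inj => /=.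
by rewrite (gr1_vop_gr0 (homog_in a) (homog_in x) (homog_in b)).
Qed.

Definition gr1_algebroid : lieAlgebroid gr0_algebra :=
  @LieAlgebroid K gr0_algebra gr1_quot gr1q_bracket gr1q_scale gr1q_act
    gr1q_bracket_linearl gr1q_bracket_linearr gr1q_bracket_alt
    gr1q_bracket_jacobi gr1q_scale_linearl gr1q_scale_linearr gr1q_scale1
    gr1q_scaleA gr1q_act_linearl gr1q_act_linearr gr1q_act_bracket
    gr1q_act_derivation gr1q_bracket_scale gr1q_act_scale.

Fact gr0_mul_linearl b : linear (gr0_mul^~ b).
Proof. by move=> k a c; apply: val_inj; rewrite /= vopDl vopZl. Qed.
Fact gr0_mulA' a b c : gr0_mul (gr0_mul a b) c = gr0_mul a (gr0_mul b c).
Proof. by rewrite gr0_mulA. Qed.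
Fact gr1q_act_leibniz x a b :
  gr1q_act x (gr0_mul a b) - gr0_mul a (gr1q_act x b) =
  gr0_mul (gr1q_act x a) b.
Proof. by rewrite gr1q_act_derivation addrK. Qed.

Definition gr0_module : lieAlgebroidModule gr1_algebroid :=
  @LieAlgebroidModule K gr0_algebra gr1_algebroid gr0_algebra
    gr1q_act gr0_mul gr1q_act_linearl gr1q_act_linearr gr1q_act_bracket
    gr0_mul_linearl gr0_mul_linear gr0_mul1 gr0_mulA' gr1q_act_leibniz
    gr1q_act_scale.
End Quotient.

Lemma linear_span_ind (P : set V) (X : set V) : subspace P -> X `<=` P -> linear_span X `<=` P.
Proof. by move=> SP XP; apply: smallest_sub. Qed.

Fact ann_gr0_subspace : subspace ann_gr0.
Proof.
apply/subspaceP; split=> [|k x y [x1 xa] [y1 ya]].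
  by split=> [|a _]; [exact: rpred0|rewrite vop0l].
split=> [|a a0]; first by rewrite rpredD// rpredZ.
by rewrite vopDl vopZl xa// ya// scaler0 addr0.
Qed.

Fact ann_gr0_bracket u x : u \in G 1%N -> ann_gr0 x -> ann_gr0 (u \_(0) x).
Proof.
move=> u1 [x1 xa]; split=> [|a a0]; first exact: (gr_vop_in u1 x1).
have ua : u \_(0) a \in G 0%N by apply: (gr_vop_in u1 a0).
have := vop0_derivation u x a 0.
by rewrite xa// vop0r xa// addr0 => <-.
Qed.

Fact ann_gr0_scale a x : a \in G 0%N -> ann_gr0 x -> ann_gr0 (a \_(-1) x).
Proof.
move=> a0 [x1 xa]; split=> [|b b0]; first exact: (gr_vop_in a0 x1).
by rewrite (gr1_vop_gr0 a0 x1 b0) xa// vop0r.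
Qed.

Fact gr0_Dop_in a : a \in G 0%N -> Dop a \in G 1%N.
Proof. by move=> a0; apply: (gr_vop_in a0 (gr_vac G)). Qed.

Fact gr0D_ann : gr0D `<=` ann_gr0.
Proof.
apply: linear_span_ind; first exact: ann_gr0_subspace.
move=> _ [a [b [a0 b0 ->]]]; apply: ann_gr0_scale => //; split.
  exact: gr0_Dop_in.
by move=> c _; rewrite Dop_vop0.
Qed.

Fact gr0D_gen a b : a \in G 0%N -> b \in G 0%N -> gr0D (a \_(-1) Dop b).
Proof. by move=> a0 b0; apply: sub_gen_smallest; exists a, b. Qed.

Fact gr0D_bracket u x : u \in G 1%N -> gr0D x -> gr0D (u \_(0) x).
Proof.
move=> u1; have [D0 Dlin] := (subspaceP _).1 (linear_span_subspace _ : subspace gr0D).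
have Dadd y z : gr0D y -> gr0D z -> gr0D (y + z).
  by move=> Dy Dz; rewrite -[y]scale1r; apply: Dlin.
move: x; apply: (@linear_span_ind [set x | gr0D (u \_(0) x)]).
  apply/subspaceP; split=> [|k x y xD yD] /=; first by rewrite vop0r.
  by rewrite vopDr vopZr; apply: Dlin.
move=> _ [a [b [a0 b0 ->]]] /=; rewrite vop0_derivation vop0_Dop.
have h c : c \in G 0%N -> u \_(0) c \in G 0%N.
  by move=> c0; apply: (gr_vop_in u1 c0).
by apply: Dadd; apply: gr0D_gen => //; apply: h.
Qed.

Fact gr0D_scale a x : a \in G 0%N -> gr0D x -> gr0D (a \_(-1) x).
Proof.
move=> a0; have [D0 Dlin] := (subspaceP _).1 (linear_span_subspace _ : subspace gr0D).
move: x; apply: (@linear_span_ind [set x | gr0D (a \_(-1) x)]).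
  apply/subspaceP; split=> [|k x y xD yD] /=; first by rewrite vop0r.
  by rewrite vopDr vopZr; apply: Dlin.
move=> _ [b [c [b0 c0 ->]]] /=.
have := gr0_vopA a0 b0 (or_intror (gr0_Dop_in c0)).
rewrite (gr0_Dop a0 c0) (gr0_Dop b0 c0) !vop0r !addr0 => <-.
by apply: gr0D_gen => //; apply: (gr_vop_in a0 b0).
Qed.

Definition ann_kernel : algebroid_kernel :=
  AlgebroidKernel ann_gr0_subspace gr0D_ann (@subset_refl _ _)
    ann_gr0_bracket ann_gr0_scale.

Definition gr0D_kernel : algebroid_kernel :=
  AlgebroidKernel (linear_span_subspace _) (@subset_refl _ _) gr0D_ann
    gr0D_bracket gr0D_scale.
End LowDegreeStructures.

(* Main.v *)
(* Indecomposability: if V is the sum of ideals U and W with U meeting W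
   trivially, write 1 = e + f. Then e_(-1) u = u on U, so the degree 0 component
   of e is an idempotent of the local algebra V_(0), hence 0 or 1. If it is 0,
   then e = e_(-1) e lies in arbitrarily high degrees, so e = 0 and U = 0; if it
   is 1, the same applies to f and W.

   Non-simplicity: let S be a subspace of V_(0) stable under V_(0) and V_(1),
   and X a set killed by all degree-lowering modes of V_(0) and V_(1), whose
   elements have degree 0 component in S. By the commutator formula, the span N
   of X under the modes of V_(0) and V_(1) that do not lower degrees is stable
   under all modes of V, and its elements still have degree 0 component in S.
   The largest subspace with the latter property stable under all modes of V is
   stable under D, hence an ideal, so the ideal generated by X contains 1 only
   if S does. Take X = rad and S = 0 in case (i), and X = S a proper nonzero
   submodule of V_(0) in cases (ii) and (iii). *)
From HB Require Import structures.
Require Import Defs.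
From mathcomp Require Import all_boot all_order all_algebra.
From mathcomp Require Import boolp classical_sets reals.
From mathcomp Require Import zify.
From mathcomp.real_closed Require Import complex.

Set Implicit Arguments.
Unset Strict Implicit.
Unset Printing Implicit Defensive.
Import Order.TTheory GRing.Theory Num.Theory.

Local Open Scope classical_set_scope.
Local Open Scope quotient_scope.
Local Open Scope ring_scope.

(** * Idempotents of a local algebra *)

Section LocalAlgebraIdempotents.
Variables (K : pzRingType) (A : commAlgebra K).
Implicit Types (I J M : set A) (a e : A).

Lemma ca_mulD a : {morph ca_mul a : x y / x + y}.
Proof. by move=> x y; rewrite -[x in LHS]scale1r ca_mul_linear scale1r. Qed.

Lemma ca_mul0 a : ca_mul a 0 = 0.
Proof. by apply: (addrI (ca_mul a 0)); rewrite -ca_mulD !addr0. Qed.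

Lemma alg_idealD I x y : alg_ideal I -> I x -> I y -> I (x + y).
Proof.
by case=> /subspaceP[_ Ilin] _ Ix Iy; rewrite -[x]scale1r; apply: Ilin.
Qed.

Lemma alg_ideal_eqT I : alg_ideal I -> I (ca_one A) -> I = setT.
Proof.
case=> _ Imul I1; apply/seteqP; split=> // x _.
by rewrite -[x]ca_mul1 ca_mulC; apply: Imul.
Qed.

Lemma alg_ideal_ann a : alg_ideal [set x | ca_mul a x = 0].
Proof.
split=> [|b x /= ax].
  apply/subspaceP; split=> [|k x y /= ax ay]; first exact: ca_mul0.
  by rewrite ca_mul_linear ax ay scaler0 addr0.
by rewrite ca_mulA (ca_mulC a) -ca_mulA ax ca_mul0.
Qed.

(** Zorn's lemma: each closure condition involves elements of a single member of the chain, and 1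
    avoids the union since it avoids each member. *)
Lemma maximal_ideal_exists I : alg_ideal I -> ~ I (ca_one A) ->
  exists2 M, maximal_ideal M & I `<=` M.
Proof.
move=> idI nI1.
(* The union with [I] makes the empty chain harmless. *)
pose P := [set J | alg_ideal (I `|` J) /\ ~ (I `|` J) (ca_one A)].
have [F FP Ftot|M [[idM nM1] Mmax]] := @Zorn_bigcup A P.
  have [[X0 FX0]|F0] := pselect (exists X, F X); last first.
    have -> : \bigcup_(X in F) X = set0.
      by apply/seteqP; split=> // x [X FX]; case: F0; exists X.
    by rewrite /P /mkset setU0.
  have inF x y : (I `|` \bigcup_(X in F) X) x -> (I `|` \bigcup_(X in F) X) y ->
      exists X, [/\ F X, (I `|` X) x & (I `|` X) y].
    move=> [Ix|[X FX Xx]] [Iy|[Y FY Yy]].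
    - by exists X0; split=> //; left.
    - by exists Y; split=> //; [left|right].
    - by exists X; split=> //; [right|left].
    - have [XY|YX] := Ftot _ _ FX FY.
        by exists Y; split=> //; right=> //; apply: XY.
      by exists X; split=> //; right=> //; apply: YX.
  have subF X : F X -> I `|` X `<=` I `|` \bigcup_(X in F) X.
    by move=> FX x [Ix|Xx]; [left|right; exists X].
  rewrite /P /=; split; last first.
    by move=> I1; have [X [FX X1 _]] := inF _ _ I1 I1; case: (FP _ FX).
  split=> [|a x Ix].
    apply/subspaceP; split=> [|k x y Ix Iy].
      by left; case: idI => /subspaceP[].
    have [X [FX Xx Xy]] := inF _ _ Ix Iy; apply: (subF _ FX).
    by have [[/subspaceP[_ Xlin] _] _] := FP _ FX; apply: Xlin.
  have [X [FX Xx _]] := inF _ _ Ix Ix; apply: (subF _ FX).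
  by have [[_ Xmul] _] := FP _ FX; apply: Xmul.
exists (I `|` M); last by move=> x Ix; left.
split=> // [MT|J idJ MJ]; first by apply: nM1; rewrite MT.
have [J1|nJ1] := pselect (J (ca_one A)).
  by right; apply: alg_ideal_eqT.
left; apply/seteqP; split=> //.
have IJ : I `|` J = J by apply: setUidr => x Ix; apply: MJ; left.
have PJ : P J by rewrite /P /mkset IJ.
have [JM x Jx|nJM] := pselect (J `<=` M); first by right; apply: JM.
by case: (Mmax J) => //; split=> // x Mx; apply: MJ; right.
Qed.

(** Otherwise the annihilators of [e] and [f] = 1 - e are proper, hence inside the unique maximal
    ideal [M]. As e f = 0, the first contains [f] and the second [e], so [M] contains f + e = 1. *)
Lemma local_idempotent e : local_algebra A -> ca_mul e e = e ->
  e = 0 \/ e = ca_one A.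
Proof.
move=> [M [[idM MT _] Muniq]] ee; apply: contrapT => /not_orP[e0 e1].
pose f := ca_one A - e.
have fE x : ca_mul f x = x - ca_mul e x.
  by rewrite ca_mulC /f ca_mulD [X in X + _]ca_mulC ca_mul1 -scaleN1r
    -[_ *: e]addr0 ca_mul_linear ca_mul0 addr0 scaleN1r (ca_mulC x).
have annM a : a <> 0 -> [set x | ca_mul a x = 0] `<=` M.
  move=> a0; have [|N maxN annN] := maximal_ideal_exists (alg_ideal_ann a).
    by rewrite /= ca_mulC ca_mul1.
  by rewrite (Muniq _ maxN).
apply: MT; apply: alg_ideal_eqT => //.
have -> : ca_one A = f + e by rewrite /f subrK.
apply: alg_idealD => //.
  by apply: (annM e) => //=; rewrite ca_mulC fE ee subrr.
apply: (annM f) => [/subr0_eq/esym//|/=].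
by rewrite fE ee subrr.
Qed.
End LocalAlgebraIdempotents.

(** * Homogeneous components and degree bounds *)

Section Components.
Variables (K : numFieldType) (V : vertexAlgebra K) (G : Ngrading V).
Implicit Types (u v w : V).

Definition decomposition v (x : nat -> V) :=
  (forall n, x n \in G n) /\
  exists M, (forall n, (M <= n)%N -> x n = 0) /\ v = \sum_(n < M) x n.

Lemma decomposition_ex v : exists x, decomposition v x.
Proof.
have [M [x [xG ->]]] := gr_span G v.
exists (fun n => if (n < M)%N then x n else 0); split=> [n|].
  by case: ifP => _ //; apply: rpred0.
exists M; split=> [n Mn|]; first by rewrite ltnNge Mn.
by apply: eq_bigr => n _; rewrite ltn_ord.
Qed.

Lemma decomposition_uniq v x y :
  decomposition v x -> decomposition v y -> x =1 y.
Proof.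
move=> [xG [M [xM vx]]] [yG [N [yN vy]]] n.
have [MNn|nMN] := leqP (M + N) n.
  by rewrite xM ?yN// (leq_trans _ MNn)// ?leq_addl// leq_addr.
apply/eqP; rewrite -subr_eq0; apply/eqP.
apply: (gr_indep (n0 := G) (N := M + N) (x := fun n => x n - y n)) => //.
  by move=> k; rewrite -scaleN1r rpredD// rpredZ.
rewrite sumrB (sum_shrink (M := M + N) _ xM) ?leq_addr//.
by rewrite (sum_shrink (M := M + N) _ yN) ?leq_addl// -vx -vy subrr.
Qed.

Definition component (n : nat) v : V := projT1 (cid (decomposition_ex v)) n.

Lemma componentP v : decomposition v (component^~ v).
Proof. exact: (projT2 (cid (decomposition_ex v))). Qed.

Lemma componentE v x n : decomposition v x -> component n v = x n.
Proof. by move=> vx; apply: (decomposition_uniq (componentP v) vx). Qed.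

Lemma component_in n v : component n v \in G n.
Proof. by have [] := componentP v. Qed.

Lemma component_linear n : linear (component n).
Proof.
move=> k u v; apply: (componentE (x := fun n => k *: component n u + component n v)).
have [uG [M [uM {1}->]]] := componentP u; have [vG [N [vN {1}->]]] := componentP v.
split=> [m|]; first by rewrite rpredD// rpredZ.
exists (M + N)%N; split=> [m MNm|].
  by rewrite uM ?vN ?scaler0 ?addr0// (leq_trans _ MNm)// ?leq_addl// leq_addr.
rewrite big_split/= -scaler_sumr (sum_shrink (M := M + N) _ uM) ?leq_addr//.
by rewrite (sum_shrink (M := M + N) _ vN) ?leq_addl.
Qed.

HB.instance Definition _ n :=
  GRing.isLinear.Build K V V *:%R (component n) (component_linear n).

Lemma component_homog (d n : nat) v : v \in G d ->
  component n v = if n == d then v else 0.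
Proof.
move=> vd; apply: (componentE (x := fun n => if n == d then v else 0)).
split=> [m|]; first by case: eqP => [->|_] //; apply: rpred0.
exists d.+1; split=> [m dm|]; first by case: eqP => // e; move: dm; rewrite e ltnn.
rewrite big_ord_recr /= eqxx big1 ?add0r// => i _.
by case: eqP => // e; move: (ltn_ord i); rewrite e ltnn.
Qed.

Lemma eq_component u v : (forall n, component n u = component n v) -> u = v.
Proof.
move=> uv; apply/eqP; rewrite -subr_eq0; apply/eqP.
have [_ [M [_ ->]]] := componentP (u - v).
by apply: big1 => i _; rewrite linearB /= uv subrr.
Qed.

Definition degree_ge (k : nat) : set V :=
  [set v | forall n, (n < k)%N -> component n v = 0].

Lemma degree_ge_homog d v : v \in G d -> degree_ge d v.
Proof. by move=> vd n nd; rewrite (component_homog _ vd) ltn_eqF. Qed.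

(** Components of degrees i >= k and j >= l contribute only in degree i + j - n - 1. *)
Lemma component_vop_eq0 k l d (n : int) u v : degree_ge k u -> degree_ge l v ->
  d%:Z < k%:Z + l%:Z - n - 1 -> component d (u \_(n) v) = 0.
Proof.
move=> uk vl dkl.
have [uG [M [_ ->]]] := componentP u; have [vG [N [_ ->]]] := componentP v.
rewrite (big_morph _ (fun x y => vopDl x y n _) (vop0l n _)) linear_sum big1// => i _.
rewrite (big_morph _ (vopDr _ n) (vop0r _ n)) linear_sum big1// => j _.
have [/uk->|ki] := ltnP i k; first by rewrite vop0l linear0.
have [/vl->|lj] := ltnP j l; first by rewrite vop0r linear0.
have := gr_vop n (uG i) (vG j).
case e: (_ - _) => [p|p] /= h; last by rewrite h linear0.
by rewrite (component_homog _ h) ifF//; apply/eqP; lia.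
Qed.

Lemma degree_ge_comp0 v : degree_ge 1 (v - component 0 v).
Proof.
move=> [|//] _.
by rewrite linearB/= (component_homog _ (component_in 0 v)) eqxx subrr.
Qed.

(* For [u] of degree [j], the mode [u_n] shifts degrees by [j - n - 1]. *)
Lemma component0_vop (j : nat) u v : degree_ge j u ->
  component 0 (u \_(j%:Z - 1) v) = component 0 (u \_(j%:Z - 1) (component 0 v)).
Proof.
move=> uj; apply/eqP; rewrite -subr_eq0 -linearB -vopNr -vopDr; apply/eqP.
by apply: (component_vop_eq0 uj (degree_ge_comp0 v)); lia.
Qed.

(** For the product u_(-1) v degrees add up, so parts of positive degree in either factor cannot
    reach degree 0. *)
Lemma component0_mul u v :
  component 0 (u \_(-1) v) = (component 0 u) \_(-1) (component 0 v).
Proof.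
rewrite (@component0_vop 0)//.
have h : (component 0 u) \_(-1) (component 0 v) \in G 0%N.
  by apply: (gr_vop_in (component_in 0 u) (component_in 0 v)).
have := component_homog 0 h; rewrite eqxx => <-.
apply/eqP; rewrite -subr_eq0 -linearB -vopNl -vopDl; apply/eqP.
by apply: (component_vop_eq0 (degree_ge_comp0 u) (l := 0)).
Qed.

(** If [e] lives in degrees >= k + 1, then e = e_(-1) e lives in degrees >= 2k + 2, so the bound
    grows without end. *)
Lemma degree_ge1_idempotent e : degree_ge 1 e -> e \_(-1) e = e -> e = 0.
Proof.
move=> e1 ee; apply: eq_component => n; rewrite linear0.
suff h k : degree_ge k.+1 e by apply: (h n).
elim: k => [//|k IH] m mk; rewrite -ee.
by apply: (component_vop_eq0 IH IH); lia.
Qed.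
End Components.

(** * Indecomposability *)

Section Decomposable.
Variables (K : numFieldType) (V : vertexAlgebra K) (G : Ngrading V).
Implicit Types (U W : set V).

Lemma complement_mul_unit U W (e f u : V) : va_ideal U -> va_ideal W ->
  U `&` W = [set 0] -> W f -> vac V = e + f -> U u -> e \_(-1) u = u.
Proof.
move=> [_ idU] [_ idW] UW Wf ef Uu.
have fu : f \_(-1) u = 0.
  suff : (U `&` W) (f \_(-1) u) by rewrite UW.
  by split; [case: (idU f u (-1) Uu)|case: (idW u f (-1) Wf)].
by have := vop_vacl (-1) u; rewrite ef vopDl fu addr0.
Qed.

Lemma complement_eq0 U W (e f : V) : va_ideal U -> va_ideal W ->
  U `&` W = [set 0] -> U e -> W f -> vac V = e + f -> component G 0 e = 0 ->
  U = [set 0].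
Proof.
move=> idU idW UW Ue Wf ef e0; have eU := complement_mul_unit idU idW UW Wf ef.
have {}e0 : e = 0.
  by apply: (@degree_ge1_idempotent _ _ G); [case|exact: eU].
apply/seteqP; split=> [u Uu|_ ->] /=; first by rewrite -(eU u Uu) e0 vop0l.
by case: idU => /subspaceP[].
Qed.

Lemma local_indecomposable :
  local_algebra (gr0_algebra G) -> va_indecomposable V.
Proof.
move=> localV [U [W [[idU idW] [[U0 _] [W0 _]] UW sumUW]]].
have [e [f [Ue Wf ef]]] := sumUW (vac V).
have ee := complement_mul_unit idU idW UW Wf ef Ue.
pose e0 : gr0_algebra G := Homog (component_in G 0 e).
have [|/(congr1 (@homog_val _ _ _ _)) e0E|/(congr1 (@homog_val _ _ _ _)) e0E]
    := local_idempotent (e := e0) localV.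
- by apply: val_inj; rewrite /= -component0_mul ee.
- exact/U0/(complement_eq0 idU idW UW Ue Wf ef).
(* Here [e] has degree 0 component 1, so that of [f] is 0, and the roles of [U] and [W] are
   swapped. *)
- apply: W0; rewrite setIC addrC in UW ef.
  apply: (complement_eq0 idW idU UW Wf Ue ef).
  move/(congr1 (component G 0)): ef.
  rewrite linearD (component_homog _ (gr_vac G)) eqxx /= /e0 /= in e0E *.
  by rewrite e0E -{1}[vac V]add0r => /addIr.
Qed.
End Decomposable.

(** * The largest ideal inside a subspace containing the image of D *)

Section LargestIdeal.
Variables (K : numFieldType) (V : vertexAlgebra K).
Implicit Types (S : set V) (u v w : V).

Lemma subspace0 S : subspace S -> S 0.
Proof. by case/subspaceP. Qed.

Lemma subspaceD S u v : subspace S -> S u -> S v -> S (u + v).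
Proof. by case/subspaceP=> _ h Su Sv; rewrite -[u]scale1r; apply: h. Qed.

Lemma subspaceZ S k v : subspace S -> S v -> S (k *: v).
Proof. by case/subspaceP=> S0 h Sv; rewrite -[_ *: _]addr0; apply: h. Qed.

Lemma subspaceB S u v : subspace S -> S u -> S v -> S (u - v).
Proof.
by move=> SS Su Sv; rewrite -scaleN1r; apply: subspaceD => //; apply: subspaceZ.
Qed.

Lemma subspace_sum S (N : nat) (F : 'I_N -> V) : subspace S ->
  (forall i, S (F i)) -> S (\sum_(i < N) F i).
Proof.
move=> SS SF; apply: (big_ind S) => //; first exact: subspace0.
by move=> u v; apply: subspaceD.
Qed.

(** Expand (u_n v)_(-2) 1 by the iterate formula: nonnegative modes kill 1, so only the terms with
    v_(-2) 1 = D v and v_(-1) 1 = v remain. *)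
Lemma Dop_vop u n v : Dop (u \_(n) v) = u \_(n) Dop v - n%:~R *: u \_(n - 1) v.
Proof.
rewrite {1}/Dop (@vop_iterate _ _ 2); first last.
- by move=> i _; rewrite vop_vacr_reg.
- by move=> i i2; rewrite vop_vacr_reg//; lia.
rewrite [X in _ - X]big1 => [|i _]; last by rewrite vop_vacr_reg// vop0r scaler0.
rewrite subr0 !big_ord_recr big_ord0 /= add0r binz0 mul1r scale1r subr0.
have -> : -2 + 1%:Z = -1 :> int by [].
by rewrite vop_vacr /binz big_ord1 subr0 divr1 expr1 mulN1r scaleNr addr0.
Qed.

(* [mode_word [:: (w1, n1); ...; (wr, nr)] v] is [wr_nr ... w1_n1 v]. *)
Definition mode_word (l : seq (V * int)) v : V :=
  foldl (fun z x => x.1 \_(x.2) z) v l.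

Lemma mode_word_linear l : linear (mode_word l).
Proof.
by elim: l => [//|[w n] l IH] k u v; rewrite /= vop_linearr; apply: IH.
Qed.

Definition ideal_core S : set V := [set v | forall l, S (mode_word l v)].

Lemma ideal_core_sub S : ideal_core S `<=` S.
Proof. by move=> v /(_ [::]). Qed.

Section Core.
Variable S : set V.
Hypotheses (SS : subspace S) (SD : forall v, S (Dop v)).

Lemma ideal_core_subspace : subspace (ideal_core S).
Proof.
apply/subspaceP; split=> [l|k x y Sx Sy l].
  by have := mode_word_linear l (-1) 0 0;
    rewrite scaler0 addr0 scaleN1r addNr => ->; apply: subspace0.
by rewrite mode_word_linear; case/subspaceP: SS => _; apply.
Qed.

Lemma ideal_core_vop w n v : ideal_core S v -> ideal_core S (w \_(n) v).
Proof. by move=> Sv l; apply: (Sv ((w, n) :: l)). Qed.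

(** [Dop_vop] pushes D outward through a word; the corrections are words with one index lowered, and
    an outermost D lands in [S] by [SD]. *)
Lemma ideal_core_Dop v : ideal_core S v -> ideal_core S (Dop v).
Proof.
move=> Sv l; elim: l v Sv => [|[w n] l IH] v Sv //=.
have -> : w \_(n) Dop v = n%:~R *: w \_(n - 1) v + Dop (w \_(n) v).
  by rewrite Dop_vop addrC subrK.
rewrite -/(mode_word l _) mode_word_linear; apply: subspaceD => //.
  by apply: subspaceZ => //; apply: (ideal_core_vop w (n - 1) Sv l).
exact/IH/ideal_core_vop.
Qed.

(** Since D 1 = 0, [Dop_vop] gives v_(m-1) 1 as -1/m times D (v_m 1); so v_(-n-1) 1 is D^n v /
    n!. *)
Lemma ideal_core_vop_vac v n : ideal_core S v -> ideal_core S (v \_(n) vac V).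
Proof.
have SC := ideal_core_subspace; move=> Sv; case: n => [n|n].
  by rewrite vop_vacr_reg//; apply: subspace0.
elim: n => [|n IH]; first by rewrite vop_vacr.
have := Dop_vop v (Negz n) (vac V).
have -> : Negz n - 1 = Negz n.+1 by lia.
rewrite /Dop vop_vacl vop0r sub0r -/(Dop _) => e.
have nz : (Negz n)%:~R != 0 :> K by rewrite intr_eq0.
have -> : v \_(Negz n.+1) vac V =
    (- (Negz n)%:~R^-1) *: Dop (v \_(Negz n) vac V).
  by rewrite e scalerN scaleNr opprK scalerA mulVf// scale1r.
exact/(subspaceZ _ SC)/ideal_core_Dop.
Qed.

(** For v_n w, write w = w_(-1) 1 and commute: every resulting term is built from some x_m 1 with x
    in the core. *)
Lemma ideal_core_ideal : va_ideal (ideal_core S).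
Proof.
have SC := ideal_core_subspace; split=> // w v n Sv.
split; first exact: ideal_core_vop.
have [N wv0] := vop_trunc w 0 v.
have h (i : nat) : (N <= i)%N -> w \_(i%:Z) v = 0.
  by move=> /wv0; rewrite add0r.
rewrite -[w in v \_(n) w]vop_vacr.
rewrite -[_ \_(n) _](subKr (w \_(-1) v \_(n) vac V)).
rewrite (vop_commutator (vac V) (-1) n h); apply: (subspaceB SC).
  exact/ideal_core_vop/ideal_core_vop_vac.
apply: (subspace_sum SC) => i; apply: (subspaceZ _ SC).
exact/ideal_core_vop_vac/ideal_core_vop.
Qed.
End Core.
End LargestIdeal.

(** * The span under nonlowering modes *)

Section NonloweringSpan.
Variables (K : numFieldType) (V : vertexAlgebra K) (G : Ngrading V).
Implicit Types (S X : set V) (t u v w y : V).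

(* A mode [y_n] with [y] of degree [j] does not lower degrees iff [n < j]. *)
Inductive nonlowering_span X : V -> Prop :=
| nonlowering_base v : X v -> nonlowering_span X v
| nonlowering0 : nonlowering_span X 0
| nonlowering_lin k u v : nonlowering_span X u -> nonlowering_span X v ->
    nonlowering_span X (k *: u + v)
| nonlowering_vop (j : nat) y (n : int) v : (j <= 1)%N -> y \in G j ->
    n < j%:Z -> nonlowering_span X v -> nonlowering_span X (y \_(n) v).

Lemma nonlowering_subspace X : subspace (nonlowering_span X).
Proof.
by apply/subspaceP; split; [exact: nonlowering0|exact: nonlowering_lin].
Qed.

Lemma low_vop (j k i : nat) u v : (j <= 1)%N -> (k <= 1)%N ->
  u \in G j -> v \in G k -> exists2 d, (d <= 1)%N & u \_(i%:Z) v \in G d.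
Proof.
move=> j1 k1 uj vk; have := gr_vop i uj vk.
case e: (_ - _) => [d|d] /= h; first by exists d => //; lia.
by exists 0%N => //; rewrite h rpred0.
Qed.

Section Annihilated.
Variable X : set V.
Hypothesis lower_X : forall (j : nat) y (n : int) x, (j <= 1)%N -> y \in G j ->
  j%:Z <= n -> X x -> y \_(n) x = 0.

(* Commuting an arbitrary mode of degree at most 1 past a nonlowering one only
   produces modes of degree at most 1, since [low_vop] keeps u_i v there. *)
Lemma nonlowering_span_low (j : nat) y n t : (j <= 1)%N -> y \in G j ->
  nonlowering_span X t -> nonlowering_span X (y \_(n) t).
Proof.
move=> j1 yj Xt; have NS := nonlowering_subspace X.
elim: Xt j y n j1 yj => {t} [x Xx||k u v _ IHu _ IHv|k x m v k1 xk mk Xv IH] j y n j1 yj.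
- have [nj|jn] := ltP n j%:Z; first exact/(nonlowering_vop j1)/nonlowering_base.
  by rewrite (lower_X j1 yj jn Xx); apply: nonlowering0.
- by rewrite vop0r; apply: nonlowering0.
- by rewrite vopDr vopZr; apply: nonlowering_lin; [exact: (IHu j)|exact: (IHv j)].
- have [N yx0] := vop_trunc y 0 x.
  have h (i : nat) : (N <= i)%N -> y \_(i%:Z) x = 0.
    by move=> /yx0; rewrite add0r.
  rewrite -[_ \_(n) _](subrK (x \_(m) y \_(n) v)) (vop_commutator v n m h).
  apply: subspaceD => //; last by apply: (nonlowering_vop k1) => //; exact: (IH j).
  apply: subspace_sum => // i; apply: subspaceZ => //.
  by have [d d1 yxd] := low_vop i j1 k1 yj xk; exact: (IH d).
Qed.

(** By the iterate formula, the vectors all of whose modes preserve the span form a vertex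
    subalgebra; it contains the generators. *)
Lemma nonlowering_span_vop : generated_by ([set` G 0%N] `|` [set` G 1%N]) ->
  forall w n t, nonlowering_span X t -> nonlowering_span X (w \_(n) t).
Proof.
move=> gen w; have NS := nonlowering_subspace X.
pose P := [set w | forall n t, nonlowering_span X t -> nonlowering_span X (w \_(n) t)].
suff : setT `<=` P by apply.
rewrite -gen; apply: smallest_sub; last first.
  by move=> y [y0|y1] n t Xt; [apply: (nonlowering_span_low (j := 0))|
    apply: (nonlowering_span_low (j := 1))].
split.
- apply/subspaceP; split=> [n t _|k u v Pu Pv n t Xt].
    by rewrite vop0l; apply: nonlowering0.
  by rewrite vopDl vopZl; apply: nonlowering_lin; [apply: Pu|apply: Pv].
- by move=> n t Xt; rewrite vop_vacl; case: ifP => // _; apply: nonlowering0.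
- move=> u l v Pu Pv n t Xt.
  have [N vt0] := vop_trunc v n t; have [M ut0] := vop_trunc u 0 t.
  rewrite (@vop_iterate _ _ (N + M)); first last.
  + by move=> i NMi; rewrite -[i%:Z]add0r; apply: ut0; lia.
  + by move=> i NMi; apply: vt0; lia.
  apply: subspaceB => //; apply: subspace_sum => // i; apply: subspaceZ => //.
    exact/Pu/Pv.
  exact/Pv/Pu.
Qed.

(** For [y] of degree j, the mode with n = j - 1 preserves degrees and acts on [S]; modes with n < j
    - 1 raise degrees and contribute nothing in degree 0. *)
Lemma component0_nonlowering S : subspace S ->
  (forall (j : nat) y x, (j <= 1)%N -> y \in G j -> S x -> S (y \_(j%:Z - 1) x)) ->
  (forall x, X x -> S (component G 0 x)) ->
  forall t, nonlowering_span X t -> S (component G 0 t).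
Proof.
move=> SS Sstab XS t; elim=> {t} [x /XS//||k u v _ Su _ Sv|j y n v j1 yj nj _ Sv].
- by rewrite linear0; apply: subspace0.
- by rewrite linearP; apply: subspaceD => //; apply: subspaceZ.
- have [->|nj1] := eqVneq n (j%:Z - 1).
    rewrite (component0_vop v (degree_ge_homog yj)) (@component_homog _ _ _ 0) //.
      exact: Sstab.
    by apply: (gr_vop_in yj (component_in G 0 v)); lia.
  rewrite (@component_vop_eq0 _ _ _ j 0) //; first exact: subspace0.
    exact: degree_ge_homog.
  by lia.
Qed.

Lemma component0_ideal_generated S :
  generated_by ([set` G 0%N] `|` [set` G 1%N]) -> subspace S ->
  (forall (j : nat) y x, (j <= 1)%N -> y \in G j -> S x -> S (y \_(j%:Z - 1) x)) ->
  (forall x, X x -> S (component G 0 x)) ->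
  forall t, ideal_generated X t -> S (component G 0 t).
Proof.
move=> gen SS Sstab XS t.
pose T := [set v | S (component G 0 v)].
have TS : subspace T.
  apply/subspaceP; split=> [|k u v Tu Tv]; rewrite /T /= ?linear0.
    exact: subspace0.
  by rewrite linearP; apply: subspaceD => //; apply: subspaceZ.
have TD v : T (Dop v).
  rewrite /T /= (@component_vop_eq0 _ _ G 0 0)//; exact: subspace0.
(* [ideal_core T] is an ideal containing [X], because every word applied to [X] stays in the
   nonlowering span. *)
move=> /(_ (ideal_core T)) Tt; apply: (ideal_core_sub (S := T)); apply: Tt.
split=> [|x Xx l]; first exact: ideal_core_ideal.
apply: component0_nonlowering => //.
have : nonlowering_span X x by apply: nonlowering_base.
elim: l x {Xx} => [//|[w n] l IH] x Xx /=.
exact/IH/nonlowering_span_vop.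
Qed.
End Annihilated.
End NonloweringSpan.

(** * Proper nonzero ideals in the three cases *)

Section NonSimple.
Variables (K : numFieldType) (V : vertexAlgebra K) (G : Ngrading V).
Hypothesis gen : generated_by ([set` G 0%N] `|` [set` G 1%N]).
Implicit Types (S X : set V) (u v y : V).

Lemma ideal_generated_ideal X : va_ideal (ideal_generated X).
Proof.
split=> [|v w n Iw].
  apply/subspaceP; split=> [I [[/subspaceP[]]]//|k u v Iu Iv I [idI XI]].
  by case: (idI) => /subspaceP[_ h] _; apply: h; [apply: Iu|apply: Iv].
by split=> I [idI XI]; case: (idI) => _ h; have [] := h v w n (Iw I (conj idI XI)).
Qed.

Lemma not_simple_generated S X :
  (forall (j : nat) y (n : int) x, (j <= 1)%N -> y \in G j ->
    j%:Z <= n -> X x -> y \_(n) x = 0) ->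
  subspace S ->
  (forall (j : nat) y x, (j <= 1)%N -> y \in G j -> S x -> S (y \_(j%:Z - 1) x)) ->
  (forall x, X x -> S (component G 0 x)) ->
  ~ S (vac V) -> ideal_generated X <> [set 0] -> ~ va_simple V.
Proof.
move=> lowX SS Sstab XS nS1 X0 /(_ _ (ideal_generated_ideal X))[//|XT]; apply: nS1.
rewrite -[vac V](_ : component G 0 (vac V) = _); last first.
  by rewrite (component_homog _ (gr_vac G)).
by apply: (component0_ideal_generated lowX gen SS Sstab XS); rewrite XT.
Qed.

(** As u_1 a has negative degree, 0 = D (u_1 a) = u_1 D a - u_0 a, and u_1 kills D a, which has
    degree 1. *)
Lemma rad_form_vop0 u a : rad_form G u -> a \in G 0%N -> u \_(0) a = 0.
Proof.
move=> [u1 urad] a0; have := Dop_vop u 1 a.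
rewrite (gr_vop_lt0 u1 a0)// (urad _ (gr0_Dop_in a0)) sub0r scale1r.
by rewrite {1}/Dop vop0l subrr => /eqP; rewrite eq_sym oppr_eq0 => /eqP.
Qed.

(** Degrees settle n > j. For n = j, the vanishing of u_i y for i >= j is turned into that of y_j u
    by applying the commutator formula to the vacuum. *)
Lemma rad_form_lower (j : nat) y (n : int) u : (j <= 1)%N -> y \in G j ->
  j%:Z <= n -> rad_form G u -> y \_(n) u = 0.
Proof.
move=> j1 yj jn ru; have [u1 urad] := ru.
have [nj|nj] := eqVneq n j%:Z; last by apply: (gr_vop_lt0 yj u1); lia.
rewrite {}nj {jn}.
have uy0 (i : nat) : (j <= i)%N -> u \_(i%:Z) y = 0.
  move=> ji; have [ij|ij] := eqVneq i j; last by apply: (gr_vop_lt0 u1 yj); lia.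
  case: j j1 yj ij {ji} => [|[|//]] _ yj ->; last exact: urad.
  exact: rad_form_vop0.
have := vop_commutator (vac V) (-1) j%:Z uy0.
rewrite vop_vacr_reg// vop0r sub0r vop_vacr => e.
apply/eqP; rewrite -oppr_eq0 e; apply/eqP.
(* Only i < j occurs, so the mode index j - 1 - i acting on the vacuum is nonnegative. *)
apply: big1 => -[i /= ij] _; rewrite vop_vacr_reg ?scaler0//.
by lia.
Qed.

Lemma rad_form_not_simple : vac V <> 0 ->
  ideal_generated (rad_form G) <> [set 0] -> ~ va_simple V.
Proof.
move=> nz1; apply: (not_simple_generated (S := [set 0])) => //.
- exact: rad_form_lower.
- by apply/subspaceP; split=> // k x y -> ->; rewrite scaler0 addr0.
- by move=> j y x _ _ ->; rewrite vop0r.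
- by move=> x [x1 _]; rewrite /= (component_homog _ x1).
Qed.

(** Lowering modes send degree 0 to negative degrees, so a proper nonzero submodule generates a
    nonzero ideal; 1 is not in the submodule, as b = b_(-1) 1 would put all of degree 0 there. *)
Lemma gr0_module_not_simple (L : algebroid_kernel G) : vac V <> 0 ->
  ~ lam_simple (gr0_module L) -> ~ va_simple V.
Proof.
move=> nz1 nsimple Vsimple; apply: nsimple; split.
  by exists (Homog (gr_vac G)) => /(congr1 (@homog_val _ _ _ _)).
move=> S [subS Sact Sscale].
pose X : set V := [set x : V | exists2 a : homog G 0%N, S a & x = a].
apply: contrapT => /not_orP[S0 ST].
have [S00 Slin] := (subspaceP _).1 subS.
apply: (not_simple_generated (S := X) (X := X)) Vsimple.
- move=> j y n _ _ yj jn [a _ ->].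
  by apply: (gr_vop_lt0 yj (homog_in a)); lia.
- apply/subspaceP; split=> [|k _ _ [a Sa ->] [b Sb ->]]; first by exists 0.
  by exists (k *: a + b) => //; apply: Slin.
- move=> [|[|//]] y _ _ yj [a Sa ->].
    by exists (gr0_mul (Homog yj) a) => //; apply: Sscale.
  exists (gr1_act (Homog yj) a) => //.
  have := Sact (\pi_(lquot (ak_pred L)) (Homog yj)) a Sa.
  by rewrite /= gr1q_actE.
- by move=> _ [a Sa ->]; rewrite (component_homog _ (homog_in a)) eqxx; exists a.
- move=> [a Sa a1]; apply: ST; apply/seteqP; split=> // b _.
  have := Sscale b a Sa; congr S; apply: val_inj.
  by rewrite /= -a1 vop_vacr.
- move=> X0; apply: S0; apply/seteqP; split=> [a Sa|_ ->] //=.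
  apply: val_inj; rewrite /=; have : ideal_generated X a.
    by apply: sub_gen_smallest; exists a.
  by rewrite X0.
Qed.
End NonSimple.

Theorem theorem1 (R : realType) (V : vertexAlgebra R[i]) (G : Ngrading V)
    (dim_gr0 : exists2 d : nat, (2 <= d)%N & has_dim (homog G 0%N) d)
    (dim_gr1 : exists2 d : nat, (1 <= d)%N & has_dim (homog G 1%N) d)
    (gen_gr01 : generated_by ([set` G 0%N] `|` [set` G 1%N]))
    (local_gr0 : local_algebra (gr0_algebra G)) :
  [\/ ideal_generated (rad_form G) <> [set 0],
      ~ lam_simple (gr0_module (ann_kernel G)) |
      ~ lam_simple (gr0_module (gr0D_kernel G))] ->
  va_indecomposable V /\ ~ va_simple V.
Proof.
move=> cases; split; first exact: local_indecomposable local_gr0.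
(* If 1 = 0, every v = 1_(-1) v vanishes, in particular the basis vector [e ord0], which gives a
   nontrivial linear relation. *)
have nz1 : vac V <> 0.
  move=> vac0; have [[|d] // _ [e [free_e _]]] := dim_gr0.
  have e0 : e ord0 = 0 by apply: val_inj; rewrite /= -[LHS](vop_vacl (-1)) vac0 vop0l.
  have := free_e (fun i => (i == ord0)%:R) _ ord0.
  rewrite (bigD1 ord0)//= e0 scaler0 add0r big1 => [/(_ erefl)/eqP|i /negPf->].
    by rewrite oner_eq0.
  by rewrite scale0r.
case: cases; first exact: rad_form_not_simple.
  exact: gr0_module_not_simple.
exact: gr0_module_not_simple.
Qed.
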